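(* Let $A=A_s+A_d\epsilon\in\mathbb{D}^{m\times n}$. Then $A^G=A^P$ if and only if $$(A_sA_s^+)A_d(I_n-A_s^+A_s)=O\quad\text{and}\quad(I_m-A_sA_s^+)A_d(A_s^+A_s)=O.$$ Moreover, setting $A_2=A-(A_sA_s^+)A_d(I_n-A_s^+A_s)\epsilon-(I_m-A_sA_s^+)A_d(A_s^+A_s)\epsilon$, one has $A^P=A_2^G$.
   Context: A dual real matrix is $A=A_s+A_d\epsilon$ with real matrices $A_s,A_d$, $\epsilon\neq0$, $\epsilon^2=0$; $A^\top=A_s^\top+A_d^\top\epsilon$. $A_s^+$ is the Moore–Penrose inverse of $A_s$. The MPDGI is $A^P=A_s^+-A_s^+A_dA_s^+\epsilon$. Every dual real matrix $B$ has an SVD $B=U\Sigma V^\top$ with $U,V$ orthogonal dual real and $\Sigma$ diagonal with entries $\mu_1\ge\dots\ge\mu_r$ positive appreciable (nonzero standard part), $\mu_{r+1}\ge\dots\ge\mu_t$ positive infinitesimal (zero standard part), and zeros (order on dual reals: $a>b$ iff $a_s>b_s$, or $a_s=b_s$ and $a_d>b_d$); the essential part is $B_e=U\begin{bmatrix}\mathrm{diag}(\mu_1,\dots,\mu_r)&O\\O&O\end{bmatrix}V^\top$, and the GMPI $B^G$ is the unique $X$ with $BXB=B_e$, $XBX=X$, $(BX)^\top=BX$, $(XB)^\top=XB$. *)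

(* Defs.v *)
From HB Require Import structures.
From mathcomp Require Import all_boot all_order all_algebra.
From mathcomp Require Import reals.
From Stdlib Require Import ClassicalEpsilon.
Set Implicit Arguments. Unset Strict Implicit. Unset Printing Implicit Defensive.
Import Order.TTheory GRing.Theory Num.Theory.
Local Open Scope ring_scope.

Section Dual.
Variable R : realType.

Definition is_MP (m n : nat) (A : 'M[R]_(m, n)) (X : 'M[R]_(n, m)) : Prop :=
  [/\ A *m X *m A = A, X *m A *m X = X,
      (A *m X)^T = A *m X & (X *m A)^T = X *m A].

Definition mpinv (m n : nat) (A : 'M[R]_(m, n)) : 'M[R]_(n, m) :=
  epsilon (inhabits 0) (is_MP A).

(* Dual real matrix A = A_s + A_d eps. *)
Record dmx (m n : nat) := DMx { dms : 'M[R]_(m, n); dmd : 'M[R]_(m, n) }.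

Definition dmul (m n p : nat) (A : dmx m n) (B : dmx n p) : dmx m p :=
  DMx (dms A *m dms B) (dms A *m dmd B + dmd A *m dms B).
Definition dtr (m n : nat) (A : dmx m n) : dmx n m :=
  DMx (dms A)^T (dmd A)^T.
Definition dadd (m n : nat) (A B : dmx m n) : dmx m n :=
  DMx (dms A + dms B) (dmd A + dmd B).
Definition dopp (m n : nat) (A : dmx m n) : dmx m n :=
  DMx (- dms A) (- dmd A).
Definition dsub (m n : nat) (A B : dmx m n) : dmx m n := dadd A (dopp B).
Definition deps (m n : nat) (M : 'M[R]_(m, n)) : dmx m n := DMx 0 M.
Definition did (n : nat) : dmx n n := DMx 1%:M 0.

Definition dorthogonal (n : nat) (U : dmx n n) : Prop :=
  dmul (dtr U) U = did n /\ dmul U (dtr U) = did n.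

(* Total order on dual numbers a = a.1 + a.2 eps. *)
Definition dnlt (a b : R * R) : Prop := a.1 < b.1 \/ (a.1 = b.1 /\ a.2 < b.2).
Definition dnle (a b : R * R) : Prop := dnlt a b \/ a = b.

Definition dentry (m n : nat) (A : dmx m n) (i : 'I_m) (j : 'I_n) : R * R :=
  (dms A i j, dmd A i j).

(* Sigma is an m x n diagonal dual matrix with diagonal entries
   mu_1 >= ... >= mu_r positive appreciable, mu_(r+1) >= ... >= mu_t positive
   infinitesimal, and the remaining diagonal entries zero. (0-based indices.) *)
Definition svd_diag (m n : nat) (S : dmx m n) (r t : nat) : Prop :=
  [/\ (r <= t)%N, (t <= minn m n)%N,
      (forall (i : 'I_m) (j : 'I_n), (i : nat) <> j -> dentry S i j = (0, 0)),
      (forall (i : 'I_m) (j : 'I_n), (i : nat) = j ->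
         [/\ ((i < r)%N -> 0 < dms S i j),
             ((r <= i)%N -> (i < t)%N -> dms S i j = 0 /\ 0 < dmd S i j)
           & ((t <= i)%N -> dentry S i j = (0, 0))])
    & (forall (i : 'I_m) (j : 'I_n) (i' : 'I_m) (j' : 'I_n),
         (i : nat) = j -> (i' : nat) = j' -> (i < i')%N -> (i' < t)%N ->
         dnle (dentry S i' j') (dentry S i j))].

Definition dtrunc (m n : nat) (S : dmx m n) (r : nat) : dmx m n :=
  DMx (\matrix_(i, j) (if (i < r)%N then dms S i j else 0))
      (\matrix_(i, j) (if (i < r)%N then dmd S i j else 0)).

Definition is_essential_part (m n : nat) (B Be : dmx m n) : Prop :=
  exists (U : dmx m m) (V : dmx n n) (S : dmx m n) (r t : nat),
    [/\ dorthogonal U, dorthogonal V, svd_diag S r t,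
        B = dmul (dmul U S) (dtr V)
      & Be = dmul (dmul U (dtrunc S r)) (dtr V)].

Definition dzero (m n : nat) : dmx m n := DMx 0 0.

Definition essential_part (m n : nat) (B : dmx m n) : dmx m n :=
  epsilon (inhabits (dzero m n)) (is_essential_part B).

Definition is_GMPI (m n : nat) (B : dmx m n) (X : dmx n m) : Prop :=
  [/\ dmul (dmul B X) B = essential_part B, dmul (dmul X B) X = X,
      dtr (dmul B X) = dmul B X & dtr (dmul X B) = dmul X B].

Definition gmpi (m n : nat) (B : dmx m n) : dmx n m :=
  epsilon (inhabits (dzero n m)) (is_GMPI B).

Definition mpdgi (m n : nat) (A : dmx m n) : dmx n m :=
  DMx (mpinv (dms A)) (- (mpinv (dms A) *m dmd A *m mpinv (dms A))).

End Dual.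

(* Main.v *)
Require Import Defs.
From mathcomp Require Import all_boot all_order all_algebra.
From mathcomp Require Import reals perm complex spectral.
From Stdlib Require Import ClassicalEpsilon.
Set Implicit Arguments. Unset Strict Implicit. Unset Printing Implicit Defensive.
Import Order.TTheory GRing.Theory Num.Theory.
Local Open Scope ring_scope.

(* Write [B] for the Moore-Penrose inverse of [As], [G = As B] and [F = B As].

   In any SVD of [A] the infinitesimal singular values contribute exactly
   [(I - G) Ad (I - F) eps], so the essential part of [A] is
   [As + (Ad - (I - G) Ad (I - F)) eps], whatever the SVD. Solving the four GMPI
   equations for this essential part gives
     [A^G = B + (- B Ad B + B B^T Ad^T (I - G) + (I - F) Ad^T B^T B) eps].
   The last two terms vanish together iff they vanish separately, which happens
   iff [(I - G) Ad F = 0] and [G Ad (I - F) = 0]; moreover [A] and [A_2] have the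
   same [B] and the same [B Ad B].

   Since the essential part is defined by an epsilon operator, an SVD must be shown
   to exist. A dual singular pair with nonzero standard part comes from a dual
   eigenvector of [A^T A]; splitting it off with dual Householder matrices reduces
   to a matrix with zero standard part, i.e. to a real SVD. Permutations and sign
   changes then put the diagonal in the required order. *)

(** * Moore-Penrose inverses and real symmetric matrices *)

Section RealMatrices.
Variable R : realType.

Lemma trmx_mul_eq0 m n (M : 'M[R]_(m, n)) : M^T *m M = 0 -> M = 0.
Proof.
move=> MM0; apply/matrixP => i j; rewrite mxE.
have /eqP := congr1 (fun N : 'M_n => N j j) MM0.
rewrite !mxE psumr_eq0 => [/allP/(_ i)|k _]; last by rewrite mxE -expr2 sqr_ge0.
by rewrite mem_index_enum => /(_ isT); rewrite mxE mulf_eq0 orbb => /eqP.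
Qed.

(** If [v] kills [F *m F^T], then [v *m F] has zero Gram matrix, hence vanishes, and [v = 0] by row
    freeness. *)
Lemma gram_unitmx m n (F : 'M[R]_(m, n)) : row_free F -> F *m F^T \in unitmx.
Proof.
move=> Ffree; rewrite -row_free_unit; apply: inj_row_free => v vFF.
apply/eqP; rewrite -(mulmx_free_eq0 v Ffree); apply/eqP/trmx_inj.
by rewrite trmx0; apply: trmx_mul_eq0; rewrite trmxK trmx_mul mulmxA -(mulmxA v) vFF mul0mx.
Qed.

(** A full-rank factorization [A = C *m F] gives the inverse [F^T (F F^T)^-1 (C^T C)^-1 C^T]. *)
Lemma is_MP_exists m n (A : 'M[R]_(m, n)) : exists X, is_MP A X.
Proof.
have [r [C [F [-> Cfree Ffree]]]] : exists r (C : 'M[R]_(m, r)) (F : 'M_(r, n)),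
    [/\ A = C *m F, row_free C^T & row_free F].
  exists (\rank A), (col_base A), (row_base A).
  by rewrite mulmx_base row_base_free /row_free mxrank_tr -/(row_full _) col_base_full.
have uF : F *m F^T \in unitmx := gram_unitmx Ffree.
have uC : C^T *m C \in unitmx by rewrite -[X in _ *m X]trmxK gram_unitmx.
set K := invmx (F *m F^T); set L := invmx (C^T *m C).
have KT : K^T = K by rewrite /K trmx_inv trmx_mul trmxK.
have LT : L^T = L by rewrite /L trmx_inv trmx_mul trmxK.
pose X := F^T *m K *m L *m C^T.
have AX : C *m F *m X = C *m L *m C^T.
  by rewrite /X !mulmxA -(mulmxA C) -(mulmxA C) mulmxV // mulmx1.
have XA : X *m (C *m F) = F^T *m K *m F.
  by rewrite /X !mulmxA -(mulmxA _ C^T) -(mulmxA _ L) mulVmx // mulmx1.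
exists X; split.
- by rewrite AX !mulmxA -(mulmxA _ C^T) -(mulmxA _ L) mulVmx // mulmx1.
- by rewrite XA /X !mulmxA -(mulmxA _ F) -(mulmxA F^T K) mulVmx // mulmx1.
- by rewrite AX !trmx_mul trmxK LT mulmxA.
- by rewrite XA !trmx_mul trmxK KT mulmxA.
Qed.

(** Symmetry lets the projectors be exchanged: [A X = (A Y)(A X)] is the transpose of
    [A X A Y = A Y], so [A X = A Y]; likewise [X A = Y A]. *)
Lemma is_MP_unique m n (A : 'M[R]_(m, n)) X Y : is_MP A X -> is_MP A Y -> X = Y.
Proof.
move=> [AXA XAX AXt XAt] [AYA YAY AYt YAt].
have eAX : A *m X = A *m Y.
  rewrite -[in LHS]AYA -mulmxA -[in LHS]AYt -[in LHS]AXt -trmx_mul mulmxA AXA.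
  exact: AYt.
have eXA : X *m A = Y *m A.
  rewrite -[in LHS]AYA 2!mulmxA -mulmxA -[in LHS]YAt -[in LHS]XAt -trmx_mul -mulmxA.
  by rewrite (mulmxA A) AXA YAt.
by rewrite -XAX eXA -mulmxA eAX mulmxA YAY.
Qed.

Lemma mpinvP m n (A : 'M[R]_(m, n)) : is_MP A (mpinv A).
Proof. exact: epsilon_spec (is_MP_exists A). Qed.

(** Uniqueness makes the inverse of a symmetric matrix symmetric; transposing [S *m mpinv S] then
    swaps its factors. *)
Lemma mpinv_sym_comm n (S : 'M[R]_n) :
  S^T = S -> S *m mpinv S = mpinv S *m S.
Proof.
move=> St; have [SXS XSX SXt XSt] := mpinvP S.
have Xt : (mpinv S)^T = mpinv S.
  apply: is_MP_unique (mpinvP S); split.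
  - by apply: trmx_inj; rewrite !trmx_mul trmxK St mulmxA.
  - by apply: trmx_inj; rewrite !trmx_mul trmxK St mulmxA.
  - by rewrite trmx_mul trmxK St -{1}XSt trmx_mul St.
  - by rewrite trmx_mul trmxK St -{1}SXt trmx_mul St.
by rewrite -SXt trmx_mul St Xt.
Qed.

(** The complex spectral theorem supplies a nonzero eigenvalue, real because [S] is Hermitian. The
    vanishing of [\det (S - a%:M)] descends to [R] and gives a real eigenvector. *)
Lemma symmetric_nonzero_eigenvector n (S : 'M[R]_n) : S^T = S -> S != 0 ->
  exists (a : R) (v : 'cV[R]_n), [/\ a != 0, v != 0 & S *m v = a *: v].
Proof.
move=> St S0; pose f := real_complex R.
have herm : map_mx f S \is hermsymmx.
  apply: realsym_hermsym.
    by apply/is_hermitianmxP; rewrite expr0 scale1r map_mx_id // map_trmx St.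
  by apply/mxOverP => i j; rewrite mxE; apply/complex_realP; exists (S i j).
have SE := orthomx_spectralP (hermitian_normalmx herm).
have [j dj] : exists j, spectral_diag (map_mx f S) 0 j != 0.
  apply/existsP; apply: contraNT S0 => /existsPn d0.
  rewrite -(map_mx_eq0 f) SE.
  suff -> : spectral_diag (map_mx f S) = 0 by rewrite linear0 mulmx0 mul0mx.
  by apply/matrixP => i k; rewrite ord1 mxE; apply/eqP; rewrite -[_ == _]negbK d0.
have /mxOverP/(_ 0 j)/complex_realP [a da] := hermitian_spectral_diag_real herm.
have {}da : spectral_diag (map_mx f S) 0 j = f a := da.
have a0 : a != 0 by apply: contraNneq dj => a0; rewrite da a0.
have /det0P [v v0 vS] : \det (S - a%:M) == 0.
  rewrite -(fmorph_eq0 f) -det_map_mx map_mxB map_scalar_mx -[X in X%:M]/(f a) -da.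
  apply/det0P; set P := spectralmx _ in SE.
  have Pu : P \in unitmx := spectral_unit _.
  exists (row j P).
    apply/negP => /eqP rP0.
    move/matrixP: (mulmxV Pu) => /(_ j j); rewrite !mxE eqxx big1 => [/eqP|k _].
      by rewrite eq_sym oner_eq0.
    by move/rowP: rP0 => /(_ k); rewrite !mxE => ->; rewrite mul0r.
  rewrite mulmxBr mul_mx_scalar -/P; apply/eqP; rewrite subr_eq0; apply/eqP.
  rewrite [in LHS]SE -row_mul 2!mulmxA mulmxV // mul1mx row_mul row_diag_mx.
  by rewrite -scalemxAl -rowE.
exists a, v^T; split=> //; first by rewrite trmx_eq0.
apply: trmx_inj; rewrite trmx_mul trmxK St linearZ /= trmxK.
by move/eqP: vS; rewrite mulmxBr mul_mx_scalar subr_eq0 => /eqP.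
Qed.

End RealMatrices.

(** * Dual singular pairs *)

Section DualSingularPair.
Variable R : realType.

Lemma normalize_cV n (v : 'cV[R]_n) : v != 0 ->
  exists c : R, (c *: v)^T *m (c *: v) = 1%:M.
Proof.
move=> v0; set q := (v^T *m v) 0 0.
have q_gt0 : 0 < q.
  rewrite lt_def; apply/andP; split.
    apply: contraNneq v0 => q0; apply/eqP/trmx_mul_eq0.
    by rewrite [LHS]mx11_scalar -/q q0 raddf0.
  by rewrite /q mxE; apply: sumr_ge0 => i _; rewrite mxE -expr2 sqr_ge0.
exists (Num.sqrt q)^-1; rewrite -scalemxAr [(_ *: v)^T]linearZ /= -scalemxAl scalerA.
rewrite [v^T *m v]mx11_scalar -/q scale_scalar_mx -expr2 exprVn sqr_sqrtr ?ltW //.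
by rewrite mulVf // gt_eqF.
Qed.

(* Degenerate perturbation theory: compress [T] to the [a]-eigenspace of [S].
   The shift [c *: Pi] makes the compression nonzero, so that an eigenvector for
   a nonzero eigenvalue automatically lies in that eigenspace. *)
Lemma dual_symmetric_eigenpair n (S T : 'M[R]_n) : S^T = S -> T^T = T -> S != 0 ->
  exists (a k : R) (v w : 'cV[R]_n), [/\ a != 0, v^T *m v = 1%:M, v^T *m w = 0,
    S *m v = a *: v & S *m w + T *m v = a *: w + k *: v].
Proof.
move=> St Tt /(symmetric_nonzero_eigenvector St) [a [x [a0 x0 Sx]]].
pose N := S - a%:M.
have Nt : N^T = N by rewrite /N linearB /= St tr_scalar_mx.
have [NXN _ _ XNt] := mpinvP N.
pose X := mpinv N; pose Pi := 1%:M - X *m N.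
have PiX : X *m N = 1%:M - Pi by rewrite /Pi opprB addrC subrK.
have Pit : Pi^T = Pi by rewrite /Pi linearB /= trmx1 XNt.
have NPi : N *m Pi = 0 by rewrite /Pi mulmxBr mulmx1 mulmxA NXN subrr.
have PiPi : Pi *m Pi = Pi by rewrite {1}/Pi mulmxBl mul1mx -mulmxA NPi mulmx0 subr0.
have Nx : N *m x = 0 by rewrite /N mulmxBl mul_scalar_mx Sx subrr.
have Pi0 : Pi != 0.
  apply: contraNneq x0 => Pi0.
  by rewrite -[x]mul1mx -[1%:M](subrK (X *m N)) -/Pi Pi0 add0r -mulmxA Nx mulmx0.
clearbody Pi.
have [c C0] : exists c : R, Pi *m T *m Pi + c *: Pi != 0.
  have [PTP0|PTP0] := eqVneq (Pi *m T *m Pi) 0.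
    by exists 1; rewrite PTP0 add0r scale1r.
  by exists 0; rewrite scale0r addr0.
have Ct : (Pi *m T *m Pi + c *: Pi)^T = Pi *m T *m Pi + c *: Pi.
  by rewrite linearD linearZ /= !trmx_mul Pit Tt mulmxA.
have [b [y [b0 y0 Cy]]] := symmetric_nonzero_eigenvector Ct C0.
have Piy : Pi *m y = y.
  apply: (scalerI b0); rewrite scalemxAr -Cy mulmxA mulmxDr -scalemxAr.
  by rewrite !mulmxA PiPi.
have PiTy : Pi *m T *m y = (b - c) *: y.
  rewrite scalerBl -Cy mulmxDl -scalemxAl Piy addrK.
  by rewrite -[in RHS](mulmxA (Pi *m T)) Piy.
have [d dyy] := normalize_cV y0.
pose v := d *: y; pose k := b - c.
have vv : v^T *m v = 1%:M := dyy.
have Piv : Pi *m v = v by rewrite -scalemxAr Piy.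
have Nv : N *m v = 0 by rewrite -Piv mulmxA NPi mul0mx.
have PiTv : Pi *m (T *m v - k *: v) = 0.
  by rewrite mulmxBr mulmxA -!scalemxAr PiTy Piy scalerA mulrC -scalerA subrr.
(* The equation [N w = - (T v - k v)] is solvable because its right side is killed by [Pi], the
   orthogonal projector onto the kernel of [N]. *)
pose w0 := - (X *m (T *m v - k *: v)).
have Nw0 : N *m w0 = - (T *m v - k *: v).
  rewrite mulmxN mulmxA (mpinv_sym_comm Nt) -/X PiX mulmxBl PiTv mul1mx.
  by rewrite subr0.
(* Removing the component along [v] gives orthogonality and leaves [N w] unchanged, as [N v = 0]. *)
pose w := w0 - v *m (v^T *m w0).
have Nw : N *m w = - (T *m v - k *: v).
  by rewrite /w mulmxBr Nw0 (mulmxA N) Nv mul0mx subr0.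
exists a, k, v, w; split=> //.
- by rewrite /w mulmxBr (mulmxA v^T) vv mul1mx subrr.
- by apply/eqP; rewrite -subr_eq0 -mul_scalar_mx -mulmxBl Nv.
- move/eqP: Nw; rewrite /N mulmxBl mul_scalar_mx subr_eq => /eqP ->.
  by rewrite opprB addrAC subrK addrC.
Qed.

(** The right vector is a unit dual eigenvector of [A^T A]; the left one is its image under [A],
    divided by the dual square root of the eigenvalue. *)
Lemma dual_singular_pair m n (As Ad : 'M[R]_(m, n)) : As != 0 ->
  exists (us ud : 'cV[R]_m) (vs vd : 'cV[R]_n) (a b : R),
  [/\ us^T *m us = 1%:M, us^T *m ud = 0, vs^T *m vs = 1%:M & vs^T *m vd = 0] /\
  [/\ As *m vs = a *: us, As *m vd + Ad *m vs = a *: ud + b *: us,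
      As^T *m us = a *: vs & As^T *m ud + Ad^T *m us = a *: vd + b *: vs].
Proof.
move=> As0.
have St : (As^T *m As)^T = As^T *m As by rewrite trmx_mul trmxK.
have Tt : (As^T *m Ad + Ad^T *m As)^T = As^T *m Ad + Ad^T *m As.
  by rewrite linearD /= !trmx_mul !trmxK addrC.
have S0 : As^T *m As != 0 by apply: contraNneq As0 => /trmx_mul_eq0 ->.
have [l [k [v [w [l0 vv vw Sv Sw]]]]] := dual_symmetric_eigenpair St Tt S0.
have l_gt0 : 0 < l.
  rewrite lt_def l0 /=; have -> : l = ((As *m v)^T *m (As *m v)) 0 0.
    by rewrite trmx_mul mulmxA -(mulmxA v^T) -mulmxA Sv -scalemxAr vv !mxE mulr1.
  by rewrite mxE; apply: sumr_ge0 => i _; rewrite mxE -expr2 sqr_ge0.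
pose a := Num.sqrt l; have a_gt0 : 0 < a by rewrite sqrtr_gt0.
have aE : a * a = l by rewrite -expr2 sqr_sqrtr ?ltW.
have an0 : a != 0 by rewrite gt_eqF.
(* [a + b eps] is the square root of [l + k eps], since its square is [a^2 + 2 a b eps]. *)
pose b := k / (a *+ 2).
pose us := a^-1 *: (As *m v).
pose ud := a^-1 *: (As *m w + Ad *m v - b *: us).
have e1 : As *m v = a *: us by rewrite scalerA mulfV // scale1r.
have e2 : As *m w + Ad *m v = a *: ud + b *: us.
  by rewrite scalerA mulfV // scale1r subrK.
have e3 : As^T *m us = a *: v.
  by rewrite -scalemxAr mulmxA Sv scalerA -aE mulKf.
have e4 : As^T *m ud + Ad^T *m us = a *: w + b *: v.
  have aud : a *: ud = As *m w + Ad *m v - b *: us by rewrite e2 addrK.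
  apply: (scalerI an0); rewrite scalerDr !scalemxAr aud -e1 mulmxBr mulmxDr.
  rewrite -scalemxAr e3 !mulmxA addrAC -(addrA (_ *m w)) -mulmxDl Sw.
  rewrite -aE scalerDr !scalerA -addrA -scalerBl; congr (_ + _ *: _).
  apply/eqP; rewrite subr_eq (mulrC b) -mulr2n -mulrnAl /b mulrC divfK //.
  by rewrite mulrn_eq0.
have uu : us^T *m us = 1%:M.
  rewrite {1}/us [(_ *: _)^T]linearZ /= -scalemxAl trmx_mul -mulmxA e3 -scalemxAr vv.
  by rewrite scalerA mulVf // scale1r.
clearbody ud; clearbody us.
(* Computing [us^T (As w + Ad v)] from [e2], then from [e3] and [e4], gives [b + a (us^T ud)] and
   [b - a (us^T ud)]; these agree only if [us^T ud = 0]. *)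
have uud : us^T *m ud = 0.
  have h1 : us^T *m (As *m w + Ad *m v) = a *: (us^T *m ud) + b%:M.
    by rewrite e2 mulmxDr -!scalemxAr uu scale_scalar_mx mulr1.
  have h2 : us^T *m (As *m w + Ad *m v) = b%:M - a *: (us^T *m ud).
    have h3 : v^T *m (As^T *m ud + Ad^T *m us) = b%:M.
      by rewrite e4 mulmxDr -!scalemxAr vw vv scaler0 add0r scale_scalar_mx mulr1.
    have h4 : us^T *m (As *m w) = 0.
      apply: trmx_inj; rewrite trmx_mul trmx_mul trmxK -mulmxA e3 -scalemxAr.
      by rewrite -[w^T *m v]trmxK trmx_mul trmxK vw !trmx0 scaler0.
    have h5 : us^T *m (Ad *m v) = v^T *m (Ad^T *m us).
      rewrite -[RHS]trmxK [X in _ = X^T]mx11_scalar tr_scalar_mx -mx11_scalar.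
      by rewrite 2!trmx_mul !trmxK mulmxA.
    rewrite mulmxDr h4 add0r h5 -h3 mulmxDr (mulmxA _ _ ud) -trmx_mul e1.
    by rewrite [(_ *: _)^T]linearZ /= -scalemxAl addrC addKr.
  move/eqP: h2; rewrite h1 addrC (inj_eq (addrI _)) -subr_eq0 opprK -mulr2n.
  by rewrite -scaler_nat !scaler_eq0 pnatr_eq0 (negbTE an0) => /eqP.
by exists us, ud, v, w, a, b.
Qed.

End DualSingularPair.

(** * Diagonalization of dual matrices *)

Section DualMatrices.
Variable R : realType.

Lemma dmx_eq m n (A B : dmx R m n) : dms A = dms B -> dmd A = dmd B -> A = B.
Proof. by case: A B => [? ?] [? ?] /= -> ->. Qed.

Lemma dmulA m n p q (A : dmx R m n) (B : dmx R n p) (C : dmx R p q) :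
  dmul A (dmul B C) = dmul (dmul A B) C.
Proof.
by apply: dmx_eq; rewrite /= ?mulmxDr ?mulmxDl !mulmxA // addrA.
Qed.

Lemma dtr_dmul m n p (A : dmx R m n) (B : dmx R n p) :
  dtr (dmul A B) = dmul (dtr B) (dtr A).
Proof. by apply: dmx_eq; rewrite /= ?linearD /= !trmx_mul // addrC. Qed.

Lemma dtrK m n (A : dmx R m n) : dtr (dtr A) = A.
Proof. by apply: dmx_eq; rewrite /= trmxK. Qed.

Lemma dmul1d m n (A : dmx R m n) : dmul (did R m) A = A.
Proof. by apply: dmx_eq; rewrite /= ?mul0mx ?addr0 mul1mx. Qed.

Lemma dmuld1 m n (A : dmx R m n) : dmul A (did R n) = A.
Proof. by apply: dmx_eq; rewrite /= ?mulmx0 ?add0r mulmx1. Qed.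

Lemma dorthogonal1 n : dorthogonal (did R n).
Proof. by split; apply: dmx_eq; rewrite /= ?trmx1 ?trmx0 ?mulmx0 ?mul0mx ?mulmx1 ?addr0. Qed.

Lemma dorthogonal_tr n (U : dmx R n n) : dorthogonal U -> dorthogonal (dtr U).
Proof. by case=> UtU UUt; split; rewrite dtrK. Qed.

Lemma dorthogonal_mul n (U V : dmx R n n) :
  dorthogonal U -> dorthogonal V -> dorthogonal (dmul U V).
Proof.
move=> [UtU UUt] [VtV VVt]; split; rewrite dtr_dmul.
  by rewrite dmulA -(dmulA _ _ U) UtU dmuld1.
by rewrite dmulA -(dmulA _ V) VVt dmuld1.
Qed.

Lemma dorthogonal_real n (U : 'M[R]_n) :
  U^T *m U = 1%:M -> dorthogonal (DMx U 0).
Proof.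
move=> UtU; have UUt := mulmx1C UtU.
by split; apply: dmx_eq; rewrite /= ?trmx0 ?mulmx0 ?mul0mx ?addr0.
Qed.

Lemma dconjK m n (U : dmx R m m) (V : dmx R n n) (A : dmx R m n) :
  dorthogonal U -> dorthogonal V ->
  dmul (dmul (dtr U) (dmul (dmul U A) (dtr V))) V = A.
Proof.
move=> [UtU _] [VtV _].
by rewrite !dmulA UtU dmul1d -dmulA VtV dmuld1.
Qed.

(** For [u != e] this is the reflection along [w = u - e]; since [w^T w = 2 (1 - c)], the usual
    coefficient [2 / (w^T w)] is [(1 - c)^-1]. *)
Lemma householder n (u e : 'cV[R]_n) : u^T *m u = 1%:M -> e^T *m e = 1%:M ->
  exists2 H : 'M[R]_n, H^T *m H = 1%:M & H *m u = e.
Proof.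
move=> uu ee; have [->|ue] := eqVneq u e.
  by exists 1%:M; rewrite ?trmx1 mul1mx.
pose c := (e^T *m u) 0 0; pose w := u - e.
have eu : e^T *m u = c%:M by rewrite [LHS]mx11_scalar.
have ue' : u^T *m e = c%:M.
  by rewrite -[LHS]trmxK trmx_mul trmxK eu tr_scalar_mx.
have wt : w^T = u^T - e^T by rewrite /w linearB.
have wu : w^T *m u = (1 - c)%:M by rewrite wt mulmxBl uu eu raddfB.
have we : w^T *m e = (c - 1)%:M by rewrite wt mulmxBl ee ue' raddfB.
have ww : w^T *m w = ((1 - c) *+ 2)%:M.
  by rewrite {2}/w mulmxBr wu we -raddfB opprB mulr2n.
have d0 : 1 - c != 0.
  apply: contraNneq ue => d0; rewrite -subr_eq0; apply/eqP/trmx_mul_eq0.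
  by rewrite -/w ww d0 mul0rn raddf0.
pose H := 1%:M - (1 - c)^-1 *: (w *m w^T).
have Ht : H^T = H.
  by rewrite /H linearB /= linearZ /= trmx1 trmx_mul trmxK.
exists H; last first.
  rewrite /H mulmxBl mul1mx -scalemxAl -mulmxA wu mul_mx_scalar scalerA mulVf //.
  by rewrite scale1r /w opprB addrC subrK.
rewrite Ht {1}/H mulmxBl mul1mx -scalemxAl -mulmxA.
have -> : w^T *m H = - w^T.
  rewrite /H mulmxBr mulmx1 -scalemxAr mulmxA ww mul_scalar_mx scalerA.
  by rewrite mulrnAr mulVf // mulr2n scalerDl scale1r opprD addNKr.
by rewrite mulmxN scalerN /H opprK subrK.
Qed.

(* A real Householder step handles the standard parts; the infinitesimal rotation
   generated by the skew matrix [e x^T - x e^T] then removes the dual part [x]. *)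
Lemma dual_householder n (us ud e : 'cV[R]_n) :
  us^T *m us = 1%:M -> us^T *m ud = 0 -> e^T *m e = 1%:M ->
  exists2 U : dmx R n n, dorthogonal U & dmul U (DMx us ud) = DMx e 0.
Proof.
move=> uu uud ee; have [H HtH Hu] := householder uu ee.
have HHt := mulmx1C HtH.
pose x := H *m ud; pose K := e *m x^T - x *m e^T.
have xe : x^T *m e = 0.
  rewrite -Hu /x trmx_mul mulmxA -(mulmxA _ _ H) HtH mulmx1.
  by rewrite -[LHS]trmxK trmx_mul trmxK uud trmx0.
have Kt : K^T = - K by rewrite /K linearB /= !trmx_mul !trmxK opprB.
have Ke : K *m e = - x.
  by rewrite /K mulmxBl -!mulmxA xe ee mulmx0 mulmx1 add0r.
exists (DMx H (K *m H)); last first.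
  by apply: dmx_eq; rewrite //= -mulmxA Hu Ke -/x subrr.
split; apply: dmx_eq => //=.
  by rewrite trmx_mul Kt mulmxN mulNmx mulmxA subrr.
by rewrite trmx_mul Kt !mulmxN mulmxA HHt mul1mx -mulmxA HHt mulmx1 addNr.
Qed.

(** The two equations prescribe the first column and the first row. *)
Lemma border_block m n (M : 'M[R]_(1 + m, 1 + n)) a :
  M *m delta_mx 0 0 = a *: delta_mx 0 0 :> 'cV_(1 + m) ->
  M^T *m delta_mx 0 0 = a *: delta_mx 0 0 :> 'cV_(1 + n) ->
  M = block_mx a%:M 0 0 (drsubmx M).
Proof.
rewrite -!colE => Mc Mr; rewrite -{1}[M]submxK.
congr block_mx; apply/matrixP => i j; rewrite ?ord1 !mxE.
- by move/matrixP: Mc => /(_ (lshift m 0) 0); rewrite !mxE !lshift0 /= mulr1n mulr1.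
- move/matrixP: Mr => /(_ (rshift 1 j) 0); rewrite !mxE lshift0 => ->.
  by rewrite andbT mulr0.
- move/matrixP: Mc => /(_ (rshift 1 i) 0); rewrite !mxE lshift0 => ->.
  by rewrite andbT mulr0.
Qed.

(** The direct sum of the dual scalar [a + b eps] and [A]. The blocks live in dimensions [1 + m] and
    [1 + n], convertible to the successors on which the induction runs. *)
Definition dbord m n (a b : R) (A : dmx R m n) : dmx R m.+1 n.+1 :=
  @DMx R (1 + m) (1 + n) (block_mx a%:M 0 0 (dms A)) (block_mx b%:M 0 0 (dmd A)).

Lemma dbord_mul m n p a b c d (A : dmx R m n) (B : dmx R n p) :
  dmul (dbord a b A) (dbord c d B) = dbord (a * c) (a * d + b * c) (dmul A B).
Proof.
apply: dmx_eq; rewrite /= !(@mulmx_block _ 1 m 1 n 1 p) -!scalar_mxM.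
  by rewrite !mulmx0 !mul0mx !addr0 !add0r.
by rewrite !mulmx0 !mul0mx !addr0 !add0r raddfD (@add_block_mx _ 1 m 1 p) !addr0.
Qed.

Lemma dbord_tr m n a b (A : dmx R m n) : dtr (dbord a b A) = dbord a b (dtr A).
Proof.
by apply: dmx_eq; rewrite /= (@tr_block_mx _ 1 m 1 n) tr_scalar_mx !trmx0.
Qed.

Lemma dbord_id n : dbord 1 0 (did R n) = did R n.+1.
Proof.
apply: dmx_eq; rewrite /= -?(scalar_mx_block 1) // raddf0.
by rewrite block_mx0.
Qed.

Lemma dorthogonal_dbord n (U : dmx R n n) :
  dorthogonal U -> dorthogonal (dbord 1 0 U).
Proof.
move=> [UtU UUt]; split;
  by rewrite dbord_tr dbord_mul ?UtU ?UUt mulr1 mulr0 mul0r addr0 dbord_id.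
Qed.

(** Dual Householder matrices carry the singular vectors to the first basis vectors, after which the
    singular pair equations clear the rest of the first row and column. *)
Lemma dual_deflation m n (A : dmx R m.+1 n.+1) : dms A != 0 ->
  exists U V a b (B : dmx R m n),
    [/\ dorthogonal U, dorthogonal V & dmul (dmul U A) (dtr V) = dbord a b B].
Proof.
move=> A0.
have [us [ud [vs [vd [a [b [[uu uud vv vvd] [e1 e2 e3 e4]]]]]]]] :=
  dual_singular_pair (dmd A) A0.
have ee k : (delta_mx 0 0 : 'cV[R]_k.+1)^T *m delta_mx 0 0 = 1%:M.
  rewrite trmx_delta mul_delta_mx; apply/matrixP => i j.
  by rewrite !ord1 !mxE.
pose e k : dmx R k.+1 1 := DMx (delta_mx 0 0) 0.
have [U oU Uu] := dual_householder uu uud (ee m).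
have [V oV Vv] := dual_householder vv vvd (ee n).
rewrite -/(e m) in Uu; rewrite -/(e n) in Vv.
set u := DMx us ud in Uu; set v := DMx vs vd in Vv.
have Av : dmul A v = dmul u (DMx a%:M b%:M).
  by apply: dmx_eq; rewrite /= !mul_mx_scalar // e2 addrC.
have Au : dmul (dtr A) u = dmul v (DMx a%:M b%:M).
  by apply: dmx_eq; rewrite /= !mul_mx_scalar // e4 addrC.
pose B := dmul (dmul U A) (dtr V).
have ud' : dmul (dtr U) (e m) = u.
  by rewrite -Uu dmulA oU.1 dmul1d.
have vd' : dmul (dtr V) (e n) = v.
  by rewrite -Vv dmulA oV.1 dmul1d.
have Be : dmul B (e n) = dmul (e m) (DMx a%:M b%:M).
  by rewrite /B -!dmulA vd' Av dmulA Uu.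
have Bte : dmul (dtr B) (e m) = dmul (e n) (DMx a%:M b%:M).
  by rewrite /B !dtr_dmul dtrK -!dmulA ud' Au dmulA Vv.
case: Be; rewrite !mul_mx_scalar mulmx0 scaler0 add0r addr0 => Bs Bd.
case: Bte; rewrite !mul_mx_scalar mulmx0 scaler0 add0r addr0 => Bts Btd.
exists U, V, a, b, (@DMx R m n (@drsubmx _ 1 m 1 n (dms B)) (@drsubmx _ 1 m 1 n (dmd B))).
split=> //; rewrite -/B; apply: dmx_eq; exact: border_block.
Qed.

(** Induction on the number of rows: deflation applies while the standard part is nonzero, and empty
    matrices fall under the zero case. *)
Lemma dual_deflation_ind (D : forall m n, dmx R m n -> Prop) :
  (forall m n (A : dmx R m n), dms A = 0 -> D m n A) ->
  (forall m n a b (A : dmx R m n), D m n A -> D m.+1 n.+1 (dbord a b A)) ->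
  (forall m n U V (A : dmx R m n), dorthogonal U -> dorthogonal V ->
     D m n (dmul (dmul U A) (dtr V)) -> D m n A) ->
  forall m n A, D m n A.
Proof.
move=> D0 Dbord Dorth; elim=> [|m IHm] [|n] A.
- by apply: D0; apply: flatmx0.
- by apply: D0; apply: flatmx0.
- by apply: D0; apply: thinmx0.
- have [/D0 //|/dual_deflation [U [V [a [b [B [oU oV E]]]]]]] := eqVneq (dms A) 0.
  by apply: (Dorth _ _ U V) => //; rewrite E; apply: Dbord.
Qed.

Definition rdiag m n (S : 'M[R]_(m, n)) :=
  forall (i : 'I_m) (j : 'I_n), (i : nat) <> j -> S i j = 0.

Lemma rdiag_block m n a (S : 'M[R]_(m, n)) :
  rdiag S -> @rdiag m.+1 n.+1 (@block_mx _ 1 m 1 n a%:M 0 0 S).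
Proof.
move=> dS i j.
case: (@split_ordP 1 m i) => i' ->; case: (@split_ordP 1 n j) => j' -> ij.
- by case: ij; rewrite !ord1.
- by rewrite (@block_mxEur _ 1 m 1 n) mxE.
- by rewrite (@block_mxEdl _ 1 m 1 n) mxE.
- by rewrite (@block_mxEdr _ 1 m 1 n) dS // => e; apply: ij; rewrite /= e.
Qed.

(* [full = false] diagonalizes only the standard part, i.e. gives a real SVD; this
   is what the case [dms A = 0] of the dual statement needs. *)
Lemma dual_diagonalization_gen (full : bool) :
  (forall m n (A : dmx R m n), dms A = 0 ->
    exists U V, [/\ dorthogonal U, dorthogonal V,
      rdiag (dms (dmul (dmul U A) (dtr V)))
    & full -> rdiag (dmd (dmul (dmul U A) (dtr V)))]) ->
  forall m n (A : dmx R m n), exists U V, [/\ dorthogonal U, dorthogonal V,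
      rdiag (dms (dmul (dmul U A) (dtr V)))
    & full -> rdiag (dmd (dmul (dmul U A) (dtr V)))].
Proof.
move=> base; apply: dual_deflation_ind => // [m n a b A|m n U V A oU oV].
  move=> [U [V [oU oV ds dd]]]; exists (dbord 1 0 U), (dbord 1 0 V).
  rewrite dbord_tr !dbord_mul; split; do ?exact: dorthogonal_dbord.
    exact: rdiag_block.
  by move=> /dd; apply: rdiag_block.
move=> [U' [V' [oU' oV' ds dd]]]; exists (dmul U' U), (dmul V' V).
rewrite dtr_dmul; split; do ?exact: dorthogonal_mul.
  by move: ds; rewrite !dmulA.
by move=> /dd; rewrite !dmulA.
Qed.

Lemma dual_diagonalization m n (A : dmx R m n) :
  exists U V, [/\ dorthogonal U, dorthogonal V,
    rdiag (dms (dmul (dmul U A) (dtr V))) & rdiag (dmd (dmul (dmul U A) (dtr V)))].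
Proof.
have zdiag p q : rdiag (0 : 'M[R]_(p, q)) by move=> i j _; rewrite mxE.
suff [U [V [oU oV ds dd]]] : exists U V, [/\ dorthogonal U, dorthogonal V,
    rdiag (dms (dmul (dmul U A) (dtr V)))
  & true -> rdiag (dmd (dmul (dmul U A) (dtr V)))] by exists U, V; split => //; apply: dd.
apply: dual_diagonalization_gen => p q [As M] /= ->.
(* With [M] as standard part, the weak form yields a real SVD of [M]; its real factors then
   diagonalize [M eps]. *)
have [|U [V [[oU _] [oV _] dM _]]] := @dual_diagonalization_gen false _ p q (DMx M M).
  move=> k l B B0; exists (did R k), (did R l); split=> //; do ?exact: dorthogonal1.
  by rewrite dmul1d /= B0 mul0mx.
move: oU oV => [oU _] [oV _].
exists (DMx (dms U) 0), (DMx (dms V) 0); split; do ?exact: dorthogonal_real.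
  by rewrite /= mulmx0 mul0mx.
by rewrite /= mulmx0 !mul0mx add0r addr0.
Qed.

End DualMatrices.

(** * Dual singular value decomposition *)

Section DualSVD.
Variable R : realType.

Lemma sorting_perm (T : eqType) (leT : rel T) m (f : 'I_m -> T) :
  total leT -> transitive leT ->
  exists s : 'S_m, forall i j : 'I_m, (i <= j)%N -> leT (f (s i)) (f (s j)).
Proof.
(* The empty case is separate because [f ord0] serves as default element of [nth] below. *)
move=> tot tr; case: m f => [|m] f; first by exists 1%g => -[].
have /tuple_permP [s sE] : perm_eq (sort leT [tuple f i | i < m.+1]) [tuple f i | i < m.+1].
  by rewrite perm_sort.
exists s => i j ij.
have := sort_sorted tot [tuple f i | i < m.+1]; rewrite sE => srt.
have rfl : reflexive leT by move=> x; have := tot x x; rewrite orbb.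
have := sorted_leq_nth tr rfl (f ord0) srt i j.
rewrite !inE size_tuple !ltn_ord !nth_mktuple !tnth_mktuple; exact.
Qed.

(** [r] is the least index from which [p] fails. This yields the counts [r] and [t] of a sorted
    diagonal. *)
Lemma initial_segment m (p : pred 'I_m) :
  (forall i j : 'I_m, (i <= j)%N -> p j -> p i) ->
  exists2 r, (r <= m)%N & forall i : 'I_m, p i = (i < r)%N.
Proof.
move=> pdown.
have exP : exists r, [forall i : 'I_m, (r <= i)%N ==> ~~ p i].
  by exists m; apply/forallP => i; rewrite leqNgt ltn_ord.
case: (ex_minnP exP) => r /forallP rP rmin; exists r.
  by apply: rmin; apply/forallP => i; rewrite leqNgt ltn_ord.
move=> i; case: ltnP => [ir|ri]; last by apply/negbTE; move/implyP: (rP i); apply.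
apply/negPn/negP => npi; move: ir; rewrite ltnNge rmin //.
apply/forallP => j; apply/implyP => ij; apply: contra npi; exact: pdown.
Qed.

(** The lexicographic order in Boolean form, as sorting requires. *)
Definition dnleb (x y : R * R) : bool :=
  (x.1 < y.1) || ((x.1 == y.1) && (x.2 <= y.2)).

Lemma dnleP x y : dnleb x y -> dnle x y.
Proof.
case: x y => [a b] [c d]; rewrite /dnleb /= => /orP [ac|/andP [/eqP -> ]].
  by left; left.
by rewrite le_eqVlt => /orP [/eqP ->|bd]; [right|left; right].
Qed.

Lemma dnleb_total : total dnleb.
Proof.
by move=> [a b] [c d]; rewrite /dnleb /=; case: ltgtP => //= _; apply: le_total.
Qed.

Lemma dnleb_trans : transitive dnleb.
Proof.
move=> [c d] [a b] [e f]; rewrite /dnleb /= => /orP [ac|/andP [/eqP -> bd]].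
  by move=> /orP [ce|/andP [/eqP <- _]]; rewrite ?ac ?(lt_trans ac ce).
move=> /orP [-> //|/andP [-> df]]; by rewrite (le_trans bd df) orbT.
Qed.

(** As the entries decrease and are nonnegative, those with positive standard part and those that
    are nonzero form initial segments, of lengths [r] and [t]. *)
Lemma svd_diag_row m q (F : 'I_m -> R * R) :
  (forall i, dnleb (0, 0) (F i)) ->
  (forall i j : 'I_m, (i <= j)%N -> dnleb (F j) (F i)) ->
  exists r t, svd_diag (DMx (row_mx (diag_mx (\row_i (F i).1)) 0 : 'M_(m, m + q))
                           (row_mx (diag_mx (\row_i (F i).2)) 0)) r t.
Proof.
move=> F_ge0 Fsort.
have [|r rm rE] := @initial_segment m (fun i => 0 < (F i).1).
  move=> i j /Fsort /orP [|/andP [/eqP -> //]] h1 h2; exact: lt_trans h1.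
have [|t tm tE] := @initial_segment m (fun i => F i != (0, 0)).
  move=> i j /Fsort ji; apply: contraNneq => Fi; move: ji (F_ge0 j).
  rewrite Fi /dnleb; case: (F j) => a b /=.
  case: ltgtP => //= -> /=.
  by move=> b0 b0'; rewrite (@le_anti _ _ b 0) // b0 b0'.
exists r, t.
have entry (i : 'I_m) (j : 'I_(m + q)) :
    dentry (DMx (row_mx (diag_mx (\row_i (F i).1)) 0 : 'M_(m, m + q))
                (row_mx (diag_mx (\row_i (F i).2)) 0)) i j =
    if (i : nat) == j then F i else (0, 0).
  rewrite /dentry /=; case: (split_ordP j) => k ->.
    rewrite !row_mxEl !mxE /= -val_eqE; case: eqP => _ //=.
    by rewrite !mulr1n; case: (F i).
  rewrite !row_mxEr !mxE /=; case: eqP => // e.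
  by have := ltn_ord i; rewrite e -ltn_subRL subnn.
have rt : (r <= t)%N.
  rewrite leqNgt; apply/negP => tr.
  have tm' : (t < m)%N by apply: leq_trans rm.
  have := rE (Ordinal tm'); rewrite /= tr; have := tE (Ordinal tm').
  by rewrite /= ltnn => /negbFE/eqP ->; rewrite ltxx.
split=> //.
- by rewrite (minn_idPl _) // leq_addr.
- by move=> i j /eqP ij; rewrite entry (negbTE ij).
- move=> i j ij; have := entry i j; rewrite ij eqxx => Fi.
  have s1 : dms _ i j = (F i).1 := congr1 fst Fi.
  have s2 : dmd _ i j = (F i).2 := congr1 snd Fi.
  rewrite s1 s2 -ij; split.
  + by rewrite -rE.
  + move=> ri it; have F1 : (F i).1 = 0.
      have := F_ge0 i; rewrite /dnleb /=.
      by rewrite rE ltnNge ri /= => /andP [/eqP].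
    split=> //; have := F_ge0 i; rewrite /dnleb /= F1 ltxx eqxx /= le_eqVlt.
    case/orP => // /eqP F2; move: it; rewrite -tE.
    by case: (F i) F1 F2 => a b /= -> <-; rewrite eqxx.
  + by move=> ti; rewrite Fi; apply/eqP; rewrite -[_ == _]negbK tE -leqNgt.
- move=> i j i' j' ij ij' ii' _; apply: dnleP.
  by rewrite !entry ij ij' !eqxx; apply: Fsort; apply: ltnW.
Qed.

Definition dual_svd m n (A : dmx R m n) : Prop :=
  exists (U : dmx R m m) (V : dmx R n n) (S : dmx R m n) (r t : nat),
    [/\ dorthogonal U, dorthogonal V, svd_diag S r t
      & A = dmul (dmul U S) (dtr V)].

Lemma perm_mx_orthogonal m (s : 'S_m) : (perm_mx s : 'M[R]_m) *m (perm_mx s)^T = 1%:M.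
Proof. by rewrite tr_perm_mx -perm_mxM mulgV perm_mx1. Qed.

Lemma perm_mx_conj_diag m (s : 'S_m) (d : 'rV[R]_m) :
  perm_mx s *m diag_mx d *m (perm_mx s)^T = diag_mx (\row_i d 0 (s i)).
Proof.
rewrite tr_perm_mx -col_permE -row_permE; apply/matrixP => i j.
by rewrite !mxE (inj_eq perm_inj).
Qed.

Lemma rdiag_row m q (S : 'M[R]_(m, m + q)) : rdiag S ->
  S = row_mx (diag_mx (\row_i S i (lshift q i))) 0.
Proof.
move=> dS; rewrite -{1}[S]hsubmxK; congr row_mx; apply/matrixP => i j; rewrite !mxE.
  case: eqVneq => [->|ij] //; rewrite dS //= => e.
  by case/eqP: ij; apply: val_inj.
by rewrite dS // => /= e; have := ltn_ord i; rewrite e -ltn_subRL subnn.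
Qed.

(** A diagonalization is corrected by signs, which make the diagonal nonnegative, and by a
    permutation, which sorts it. *)
Lemma dual_svd_wide m q (A : dmx R m (m + q)) : dual_svd A.
Proof.
have [U [V [oU oV /rdiag_row ds /rdiag_row dd]]] := dual_diagonalization A.
move: ds dd (erefl (dmul (dmul U A) (dtr V))).
(* The right side of the reflexive equation is left alone, so that [SE] records what [S] stands
   for. *)
move: {1 2 3 4 5}(dmul (dmul U A) (dtr V)) => S ds dd SE.
pose f i := dentry S i (lshift q i).
pose g i : R := if dnleb (0, 0) (f i) then 1 else -1.
pose h i : R * R := (g i * (f i).1, g i * (f i).2).
have h_ge0 i : dnleb (0, 0) (h i).
  rewrite /h /g; case: ifP => [|/negbT]; first by rewrite !mul1r -surjective_pairing.
  rewrite /dnleb /= !mulN1r oppr_gt0 (eq_sym 0 (- _)) oppr_eq0 oppr_ge0.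
  by case: (ltgtP 0 (f i).1) => //= _; rewrite -ltNge => /ltW.
(* The order is reversed because singular values must decrease. *)
have [s hs] := sorting_perm h (leT := fun x y => dnleb y x)
  (fun x y => dnleb_total y x) (fun y x z xy yz => dnleb_trans yz xy).
pose G := diag_mx (\row_i g i); pose P : 'M[R]_m := perm_mx s.
have gg i : g i * g i = 1 by rewrite /g; case: ifP; rewrite ?mulr1 ?mulrNN ?mulr1.
have GG : G *m G = 1%:M.
  rewrite mulmx_diag -diag_const_mx; congr diag_mx; apply/rowP => i.
  by rewrite !mxE gg.
have PPt : P *m P^T = 1%:M := perm_mx_orthogonal s.
have PtP : P^T *m P = 1%:M := mulmx1C PPt.
(* Signs act on the rows only, so each entry receives its sign once; [N] permutes the first [m]
   columns alike and fixes the other [q]. *)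
pose L := P *m G; pose N : 'M_(m + q) := block_mx P 0 0 1%:M.
have oL : dorthogonal (DMx L 0).
  by apply: dorthogonal_real; rewrite /L trmx_mul tr_diag_mx mulmxA -(mulmxA _ P^T) PtP mulmx1.
have oN : dorthogonal (DMx N 0).
  apply: dorthogonal_real; rewrite /N tr_block_mx !trmx0 trmx1 mulmx_block.
  by rewrite !mulmx0 !mul0mx mulmx1 PtP !addr0 add0r -scalar_mx_block.
have conj (d : 'rV[R]_m) :
    L *m row_mx (diag_mx d) 0 *m N^T = row_mx (diag_mx (\row_i (g (s i) * d 0 (s i)))) 0.
  rewrite mul_mx_row mulmx0 /N tr_block_mx !trmx0 trmx1 mul_row_block.
  rewrite !mulmx0 mul0mx addr0 addr0 /L -(mulmxA P) mulmx_diag perm_mx_conj_diag.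
  by congr (row_mx (diag_mx _) _); apply/rowP => i; rewrite !mxE.
have [r [t svd]] := svd_diag_row q (F := h \o s) (fun i => h_ge0 _) hs.
pose S' := dmul (dmul (DMx L 0) S) (dtr (DMx N 0)).
exists (dmul (dtr U) (dtr (DMx L 0))), (dmul (dtr V) (dtr (DMx N 0))), S', r, t.
split.
- by apply: dorthogonal_mul; apply: dorthogonal_tr.
- by apply: dorthogonal_mul; apply: dorthogonal_tr.
- suff -> : S' = DMx (row_mx (diag_mx (\row_i ((h \o s) i).1)) 0)
                    (row_mx (diag_mx (\row_i ((h \o s) i).2)) 0) by [].
  apply: dmx_eq; rewrite /S' /= ?trmx0 ?mul0mx ?mulmx0 ?addr0 ?add0r.
    rewrite {1}ds conj.
    by congr (row_mx (diag_mx _) _); apply/rowP => i; rewrite !mxE.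
  rewrite {1}dd conj.
  by congr (row_mx (diag_mx _) _); apply/rowP => i; rewrite !mxE.
- rewrite dtr_dmul !dtrK -!dmulA.
  by rewrite -[LHS](dconjK _ oU oV) -SE -[in LHS](dconjK S oL oN) -/S' !dmulA.
Qed.

Lemma dual_svd_tr m n (A : dmx R m n) : dual_svd (dtr A) -> dual_svd A.
Proof.
move=> [U [V [S [r [t [oU oV [rt tmn off on srt] AE]]]]]].
exists V, U, (dtr S), r, t; split=> //; last first.
  by rewrite -[A]dtrK AE !dtr_dmul dtrK dmulA.
have tE i j : dentry (dtr S) i j = dentry S j i by rewrite /dentry /= !mxE.
split=> //; first by rewrite minnC.
- by move=> i j ij; rewrite tE off // => e; apply: ij.
- move=> i j ij; rewrite tE /= !mxE ij; exact: on.
- by move=> i j i' j' ij ij'; rewrite !tE ij ij'; apply: srt.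
Qed.

Lemma dual_svd_exists m n (A : dmx R m n) : dual_svd A.
Proof.
case: (leqP m n) => [mn|/ltnW nm].
  by move: A; rewrite -(subnKC mn) => A; apply: dual_svd_wide.
by apply: dual_svd_tr; move: (dtr A); rewrite -(subnKC nm) => B; apply: dual_svd_wide.
Qed.

End DualSVD.

(** * Essential part and GMPI *)

Section GMPI.
Variable R : realType.

(** The discarded part [Y eps] satisfies [(I - G) Y (I - F) = Y], whereas [(I - G) Ed (I - F) = 0]
    for the dual part [Ed] of [E]. Compressing [Ad = Ed + Y] therefore isolates [Y]. *)
Lemma is_essential_part_unique m n (A E : dmx R m n) B :
  is_MP (dms A) B -> is_essential_part A E ->
  E = DMx (dms A)
    (dmd A - (1%:M - dms A *m B) *m dmd A *m (1%:M - B *m dms A)).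
Proof.
move=> [ABA BAB ABt BAt] [U [V [S [r [t [[UtU UUt] [VtV VVt] svd AE EE]]]]]].
have [rt tmn off on _] := svd.
case: UtU => UtU _; case: VtV => VtV _.
set T := dtrunc S r in EE.
have TsE : dms T = dms S.
  apply/matrixP => i j; rewrite mxE; case: ltnP => // ri.
  have [ij|/eqP ij] := eqVneq (i : nat) j; last by case: (off _ _ ij).
  have [_ inf zero] := on _ _ ij.
  by case: (ltnP i t) => [/(inf ri) [->] //|/zero [->]].
(* [D] lives on diagonal positions of index at least [r], where the standard part of [S] vanishes;
   hence both products with [(dms S)^T] are zero. *)
pose D := dmd S - dmd T.
have SD : (dms S)^T *m D = 0.
  apply/matrixP => j k; rewrite !mxE big1 // => i _; rewrite !mxE.
  case: ltnP => ri; first by rewrite subrr mulr0.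
  by move/matrixP: TsE => /(_ i j); rewrite mxE ltnNge ri /= => <-; rewrite mul0r.
have DS : D *m (dms S)^T = 0.
  apply/matrixP => i k; rewrite !mxE big1 // => j _; rewrite !mxE.
  case: ltnP => ri; first by rewrite subrr mul0r.
  have [ij|/eqP ij] := eqVneq (i : nat) j; last first.
    by case: (off _ _ ij) => _ ->; rewrite subrr mul0r.
  have [kj|/eqP kj] := eqVneq (k : nat) j; last first.
    by case: (off _ _ kj) => -> _; rewrite mulr0.
  have -> : k = i by apply: val_inj; rewrite /= kj ij.
  by move/matrixP: TsE => /(_ i j); rewrite mxE ltnNge ri /= => <-; rewrite mulr0.
have AsE : dms A = dms U *m dms S *m (dms V)^T by rewrite AE.
have EsE : dms E = dms A by rewrite AsE -TsE EE.
have Ed : dmd E = dms U *m dms S *m (dmd V)^T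
    + (dms U *m dmd T + dmd U *m dms S) *m (dms V)^T by rewrite -TsE EE.
have Ad : dmd A = dms U *m dms S *m (dmd V)^T
    + (dms U *m dmd S + dmd U *m dms S) *m (dms V)^T by rewrite AE.
pose Y := dms U *m D *m (dms V)^T.
have EdE : dmd E = dmd A - Y.
  rewrite Ad Ed /Y /D mulmxBr -addrA -mulmxBl; congr (_ + _ *m _).
  by rewrite opprB [RHS]addrC addrA subrK.
have AtY : (dms A)^T *m Y = 0.
  rewrite AsE /Y !trmx_mul trmxK !mulmxA -(mulmxA _ (dms U)^T) UtU mulmx1.
  by rewrite -(mulmxA _ _ D) SD mulmx0 mul0mx.
have YAt : Y *m (dms A)^T = 0.
  rewrite AsE /Y !trmx_mul trmxK !mulmxA -(mulmxA _ (dms V)^T) VtV mulmx1.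
  by rewrite -(mulmxA _ D) DS mulmx0 mul0mx.
set G := dms A *m B; set F := B *m dms A.
have GY : G *m Y = 0 by rewrite /G -ABt trmx_mul -mulmxA AtY mulmx0.
have YF : Y *m F = 0 by rewrite /F -BAt trmx_mul mulmxA YAt mul0mx.
have GY1 : (1%:M - G) *m Y *m (1%:M - F) = Y.
  by rewrite mulmxBl mul1mx GY subr0 mulmxBr mulmx1 YF subr0.
have GA : (1%:M - G) *m dms A = 0 by rewrite mulmxBl mul1mx ABA subrr.
have AF : dms A *m (1%:M - F) = 0 by rewrite mulmxBr mulmx1 mulmxA ABA subrr.
have USE : dms U *m dms S = dms A *m dms V.
  by rewrite AsE -mulmxA VtV mulmx1.
have SVE : dms S *m (dms V)^T = (dms U)^T *m dms A.
  by rewrite AsE !mulmxA UtU mul1mx.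
(* For [j < r] the entry [S j j] has nonzero standard part, so column [j] of [dms U] lies in the
   range of [As] and is killed by [I - G]; the other rows of [dmd T] are zero. *)
have GU : (1%:M - G) *m dms U *m dmd T = 0.
  have GUS : (1%:M - G) *m dms U *m dms S = 0 by rewrite -mulmxA USE mulmxA GA mul0mx.
  apply/matrixP => i k; rewrite !mxE big1 // => j _.
  rewrite [dmd T j k]mxE; case: ltnP => jr; last by rewrite mulr0.
  have jn : (j < n)%N.
    by apply: leq_trans jr _; apply: leq_trans rt (leq_trans tmn (geq_minr _ _)).
  have [/(_ jr) Sj _ _] := on j (Ordinal jn) erefl.
  suff -> : ((1%:M - G) *m dms U) i j = 0 by rewrite mul0r.
  move/matrixP: GUS => /(_ i (Ordinal jn)); rewrite mxE (bigD1 j) //= big1.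
    rewrite addr0 [RHS]mxE => /eqP.
    by rewrite mulf_eq0 (gt_eqF Sj) orbF => /eqP.
  move=> l lj; have /= lj' : (l : nat) <> Ordinal jn by move/val_inj=> e; rewrite e eqxx in lj.
  by case: (off l (Ordinal jn) lj') => -> _; rewrite mulr0.
have GEF : (1%:M - G) *m dmd E *m (1%:M - F) = 0.
  move: (1%:M - G) (1%:M - F) GA GU AF => G' F' G'A G'U AF'.
  rewrite Ed USE mulmxDl !mulmxDr !mulmxDl !mulmxA G'A G'U !mul0mx !add0r.
  by rewrite -(mulmxA _ (dms S)) SVE -!mulmxA AF' !mulmx0.
apply: dmx_eq => //=; rewrite {1}EdE; congr (_ - _).
have -> : dmd A = dmd E + Y by rewrite EdE subrK.
move: (1%:M - G) (1%:M - F) GEF GY1 => G' F' G'E G'Y.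
by rewrite mulmxDr mulmxDl G'E add0r G'Y.
Qed.

(** Existence of a dual SVD makes the epsilon choice a genuine essential part; uniqueness gives its
    value. *)
Lemma essential_partE m n (A : dmx R m n) :
  essential_part A = DMx (dms A)
    (dmd A - (1%:M - dms A *m mpinv (dms A)) *m dmd A *m
             (1%:M - mpinv (dms A) *m dms A)).
Proof.
apply: is_essential_part_unique (mpinvP _) _; apply: epsilon_spec.
have [U [V [S [r [t [oU oV svd AE]]]]]] := dual_svd_exists A.
by exists (dmul (dmul U (dtrunc S r)) (dtr V)), U, V, S, r, t.
Qed.

(** The standard parts are Moore-Penrose inverses of [As]. The difference [Z] of the dual parts
    satisfies [As Z As = 0] with [As Z] and [Z As] symmetric, which forces both products to vanish;
    then [Z = B As Z + Z As B = 0]. *)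
Lemma is_GMPI_unique m n (A : dmx R m n) X Y : is_GMPI A X -> is_GMPI A Y -> X = Y.
Proof.
rewrite /is_GMPI essential_partE => -[AXA XAX AXt XAt] [AYA YAY AYt YAt].
have XsY : dms X = dms Y.
  apply: (@is_MP_unique _ _ _ (dms A)); split.
  - exact: (congr1 (@dms R m n) AXA).
  - exact: (congr1 (@dms R n m) XAX).
  - exact: (congr1 (@dms R m m) AXt).
  - exact: (congr1 (@dms R n n) XAt).
  - exact: (congr1 (@dms R m n) AYA).
  - exact: (congr1 (@dms R n m) YAY).
  - exact: (congr1 (@dms R m m) AYt).
  - exact: (congr1 (@dms R n n) YAt).
apply: dmx_eq => //.
move: AXA XAX AXt XAt; case: X XsY => Xs Xd /= ->.
move: AYA YAY AYt YAt; case: Y => B Yd; case: A => As Ad /=.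
move=> [ABA AYA] [BAB YAY] [ABt AYt] [BAt YAt] [_ AXA] [_ XAX] [_ AXt] [_ XAt].
pose Z := Xd - Yd.
have AZA : As *m Z *m As = 0.
  have : (As *m Xd + Ad *m B) *m As = (As *m Yd + Ad *m B) *m As.
    by apply: (addrI (As *m B *m Ad)); rewrite AXA AYA.
  by move/eqP; rewrite -subr_eq0 -mulmxBl opprD addrACA subrr addr0 -mulmxBr => /eqP.
have AZt : (As *m Z)^T = As *m Z.
  have -> : As *m Z = (As *m Xd + Ad *m B) - (As *m Yd + Ad *m B).
    by rewrite opprD addrACA subrr addr0 mulmxBr.
  by rewrite linearB /= AXt AYt.
have ZAt : (Z *m As)^T = Z *m As.
  have -> : Z *m As = (B *m Ad + Xd *m As) - (B *m Ad + Yd *m As).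
    by rewrite opprD addrACA subrr add0r mulmxBl.
  by rewrite linearB /= XAt YAt.
have AZ : As *m Z = 0.
  rewrite -[in LHS]ABA -mulmxA -AZt -ABt -trmx_mul mulmxA AZA mul0mx.
  exact: trmx0.
have ZA : Z *m As = 0.
  rewrite -[in LHS]ABA -mulmxA mulmxA -ZAt -BAt -trmx_mul -mulmxA (mulmxA As) AZA mulmx0.
  exact: trmx0.
have ZE : Z = B *m As *m Z + Z *m As *m B.
  rewrite {1}/Z -[in LHS]XAX -[in LHS]YAY opprD addrACA -mulmxBr -mulmxBl.
  by rewrite opprD addrACA subrr add0r -mulmxBl.
apply/eqP; rewrite -subr_eq0 -/Z ZE -mulmxA AZ ZA mulmx0 mul0mx addr0.
exact: eqxx.
Qed.

Lemma gmpiE m n (A : dmx R m n) (B := mpinv (dms A)) :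
  gmpi A = DMx B (- (B *m dmd A *m B)
    + (B *m B^T *m (dmd A)^T *m (1%:M - dms A *m B)
       + (1%:M - B *m dms A) *m (dmd A)^T *m B^T *m B)).
Proof.
set X := (X in _ = X); suff gm : is_GMPI A X.
  exact: (is_GMPI_unique (epsilon_spec (inhabits (dzero R n m)) _ (ex_intro _ X gm)) gm).
have [ABA BAB ABt BAt] := mpinvP (dms A); rewrite -/B in ABA BAB ABt BAt.
have BG : B *m (dms A *m B) = B by rewrite mulmxA.
have GBt : dms A *m B *m B^T = B^T by rewrite -{1}ABt -trmx_mul BG.
have BtF : B^T *m (B *m dms A) = B^T by rewrite -{1}BAt -trmx_mul BAB.
rewrite /X /is_GMPI essential_partE -/B.
case: A @B @X ABA BAB ABt BAt BG GBt BtF => As Ad /=; move: (mpinv As) => B.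
move=> ABA BAB ABt BAt BG GBt BtF.
set G := As *m B; set F := B *m As.
have GA : (1%:M - G) *m As = 0 by rewrite mulmxBl mul1mx ABA subrr.
have AF : As *m (1%:M - F) = 0 by rewrite mulmxBr mulmx1 mulmxA ABA subrr.
have BG' : (1%:M - F) *m B = 0 by rewrite mulmxBl mul1mx BAB subrr.
have GB' : B *m (1%:M - G) = 0 by rewrite mulmxBr mulmx1 BG subrr.
(* With [- B Ad B] alone, the dual parts of [A X] and [X A] would be [C] and [E]. The corrections
   [B C^T] and [E^T B] symmetrize them to [C + C^T] and [E + E^T]. *)
set C := (1%:M - G) *m Ad *m B.
set E := B *m Ad *m (1%:M - F).
have Ct : C^T = B^T *m Ad^T *m (1%:M - G).
  by rewrite /C !trmx_mul linearB /= trmx1 ABt mulmxA.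
have Et : E^T = (1%:M - F) *m Ad^T *m B^T.
  by rewrite /E !trmx_mul linearB /= trmx1 BAt mulmxA.
set Xd := - (B *m Ad *m B) + _.
have XdE : Xd = - (B *m Ad *m B) + (B *m C^T + E^T *m B).
  by rewrite /Xd Ct Et !mulmxA.
have CtA : C^T *m As = 0 by rewrite Ct -(mulmxA _ _ As) GA mulmx0.
have AEt : As *m E^T = 0 by rewrite Et !mulmxA AF !mul0mx.
have GCt : As *m B *m C^T = C^T by rewrite Ct !mulmxA GBt.
have EtF : E^T *m (B *m As) = E^T by rewrite Et -!mulmxA BtF.
have AX : As *m Xd + Ad *m B = C + C^T.
  rewrite XdE !mulmxDr mulmxN !mulmxA AEt mul0mx addr0 GCt addrAC.
  by rewrite /C mulmxBl mulmxBl mul1mx [X in X + _]addrC.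
have XA : B *m Ad + Xd *m As = E + E^T.
  rewrite XdE !mulmxDl mulNmx -!mulmxA CtA mulmx0 add0r EtF addrA.
  by rewrite /E mulmxBr mulmx1 -!mulmxA.
split; apply: dmx_eq => //=.
(* The dual part of [A X A] is [G Ad + (I - G) Ad F], that is [Ad - (I - G) Ad (I - F)]. *)
- have GAd : Ad - (1%:M - G) *m Ad = G *m Ad by rewrite mulmxBl mul1mx opprB addrC subrK.
  rewrite AX (mulmxDl C) CtA addr0 /C -(mulmxA _ B As) -/F -/G -GAd.
  by rewrite [in RHS]mulmxBr mulmx1 opprB addrCA addrC.
- have EB : E *m B = 0 by rewrite /E -(mulmxA _ _ B) BG' mulmx0.
  rewrite XA (mulmxDl E) EB add0r XdE !mulmxDr mulmxN (mulmxA _ E^T).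
  by rewrite -(mulmxA B As E^T) AEt mulmx0 mul0mx addr0 !mulmxA BAB addrA.
- by rewrite AX linearD /= trmxK addrC.
- by rewrite XA linearD /= trmxK addrC.
Qed.

End GMPI.

(** * Comparison of the GMPI with the MPDGI *)

Theorem theorem5p4 (R : realType) (m n : nat) (A : dmx R m n) :
  let As := dms A in
  let Ad := dmd A in
  let Asp := mpinv As in
  let P := As *m Asp *m Ad *m (1%:M - Asp *m As) in
  let Q := (1%:M - As *m Asp) *m Ad *m (Asp *m As) in
  (gmpi A = mpdgi A <-> (P = 0 /\ Q = 0)) /\
  mpdgi A = gmpi (dsub (dsub A (deps P)) (deps Q)).
Proof.
move=> As Ad B P Q.
have [ABA BAB ABt BAt] := mpinvP As; rewrite -/B in ABA BAB ABt BAt.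
have FF : B *m As *m (B *m As) = B *m As by rewrite mulmxA BAB.
have GG : As *m B *m (As *m B) = As *m B by rewrite mulmxA ABA.
have GBt : As *m B *m B^T = B^T by rewrite -{1}ABt -trmx_mul mulmxA BAB.
have BtF : B^T *m (B *m As) = B^T by rewrite -{1}BAt -trmx_mul BAB.
have FG : (1%:M - B *m As) *m B = 0 by rewrite mulmxBl mul1mx BAB subrr.
have BG : B *m (1%:M - As *m B) = 0 by rewrite mulmxBr mulmx1 mulmxA BAB subrr.
have FF' : (1%:M - B *m As) *m (B *m As) = 0 by rewrite mulmxA FG mul0mx.
have F'F : B *m As *m (1%:M - B *m As) = 0 by rewrite mulmxBr mulmx1 FF subrr.
have GG' : As *m B *m (1%:M - As *m B) = 0 by rewrite -mulmxA BG mulmx0.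
have G'G : (1%:M - As *m B) *m (As *m B) = 0 by rewrite mulmxBl mul1mx GG subrr.
have G'A : (1%:M - As *m B) *m As = 0 by rewrite mulmxBl mul1mx ABA subrr.
have F'F' : (1%:M - B *m As) *m (1%:M - B *m As) = 1%:M - B *m As.
  by rewrite [LHS]mulmxBr mulmx1 FF' subr0.
have G'G' : (1%:M - As *m B) *m (1%:M - As *m B) = 1%:M - As *m B.
  by rewrite [LHS]mulmxBr mulmx1 G'G subr0.
have Ft : (1%:M - B *m As)^T = 1%:M - B *m As by rewrite linearB /= trmx1 BAt.
have Gt : (1%:M - As *m B)^T = 1%:M - As *m B by rewrite linearB /= trmx1 ABt.
(* The correction terms of the GMPI factor through the transposes of the two compressions of [M].
   The claim is general in [M] to serve both [Ad] and the dual part of [A2]. *)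
have gen (M : 'M[R]_(m, n)) : As *m B *m M *m (1%:M - B *m As) = 0 ->
    (1%:M - As *m B) *m M *m (B *m As) = 0 ->
    B *m B^T *m M^T *m (1%:M - As *m B) + (1%:M - B *m As) *m M^T *m B^T *m B = 0.
  move=> PM QM.
  have -> : B *m B^T *m M^T *m (1%:M - As *m B) =
      B *m ((1%:M - As *m B) *m M *m (B *m As *m B))^T.
    by rewrite BAB !trmx_mul Gt !mulmxA.
  have -> : (1%:M - B *m As) *m M^T *m B^T *m B =
      (B *m (As *m B) *m M *m (1%:M - B *m As))^T *m B.
    by rewrite (mulmxA B) BAB !trmx_mul Ft !mulmxA.
  rewrite (mulmxA _ (B *m As) B) QM mul0mx trmx0 mulmx0 add0r.
  rewrite (_ : B *m (As *m B) *m M *m _ = B *m (As *m B *m M *m (1%:M - B *m As))).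
    by rewrite PM mulmx0 trmx0 mul0mx.
  by rewrite !mulmxA.
split; first split.
- rewrite gmpiE /mpdgi -/As -/Ad -/B => -[/(canRL (addKr _))].
  rewrite addNr => E0.
  (* Left multiplication by [B *m As] kills the second correction term and fixes the first, so the
     two vanish separately. *)
  have FE : B *m As *m ((1%:M - B *m As) *m Ad^T *m B^T *m B) = 0.
    by rewrite !(mulmxA (B *m As)) F'F !mul0mx.
  have Q0 : B *m B^T *m Ad^T *m (1%:M - As *m B) = 0.
    have := congr1 (mulmx (B *m As)) E0.
    by rewrite mulmx0 mulmxDr FE addr0 !mulmxA BAB.
  have P0 : (1%:M - B *m As) *m Ad^T *m B^T *m B = 0 by rewrite -[LHS]add0r -{1}Q0.
  split; apply: trmx_inj; rewrite trmx0 trmx_mul.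
    (* This form of [As *m B] exposes the vanishing factor [(I - F) Ad^T B^T B] in [P^T]; [AABB]
       does the same for [Q^T]. *)
    have BBAA : As *m B = B^T *m B *m As *m As^T.
      by rewrite -(mulmxA _ B) BtF -trmx_mul ABt.
    by rewrite Ft trmx_mul ABt BBAA !mulmxA P0 !mul0mx.
  have AABB : B *m As = As^T *m (As *m (B *m B^T)).
    by rewrite (mulmxA As) GBt -trmx_mul BAt.
  rewrite BAt trmx_mul Gt AABB -!mulmxA (mulmxA B) (mulmxA _ Ad^T).
  by rewrite Q0 !mulmx0.
- by move=> [P0 Q0]; rewrite gmpiE -/As -/Ad -/B gen // addr0.
set A2 := dsub _ _.
have A2s : dms A2 = As by rewrite /= !oppr0 !addr0.
have A2d : dmd A2 = Ad - P - Q by [].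
have A2E k l (X : 'M_(k, m)) (Y : 'M_(n, l)) :
    X *m dmd A2 *m Y = X *m Ad *m Y - X *m P *m Y - X *m Q *m Y.
  rewrite A2d; move: (P) (Q) => P' Q'.
  by rewrite !mulmxBr !mulmxBl.
(* Compressing by [G] and [I - F] fixes [P] and kills [Q]; compressing by [I - G] and [F] does the
   opposite. Both compressions of the dual part of [A2] are thus zero, as [gen] requires. *)
rewrite gmpiE A2s -/B gen ?addr0 A2E.
- rewrite /mpdgi -/As -/Ad -/B; congr (DMx _ (- _)).
  have PB : P *m B = 0 by rewrite /P -(mulmxA _ _ B) FG mulmx0.
  have BQ : B *m Q = 0 by rewrite /Q !(mulmxA B) BG !mul0mx.
  by rewrite -(mulmxA B P) PB BQ mulmx0 mul0mx !subr0.
- have -> : As *m B *m P *m (1%:M - B *m As) = P.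
    by rewrite /P !(mulmxA (As *m B)) ABA -(mulmxA _ (1%:M - _)) F'F'.
  by rewrite subrr /Q !(mulmxA (As *m B)) GG' !mul0mx subr0.
- have -> : (1%:M - As *m B) *m Q *m (B *m As) = Q.
    by rewrite /Q !(mulmxA (1%:M - As *m B)) G'G' -(mulmxA _ (B *m As)) FF.
  by rewrite addrAC subrr /P !(mulmxA (1%:M - As *m B)) G'A !mul0mx subr0.
Qed.
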